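(* Assume: (i) there are constants $M_{\mathbf P},M_{\mathbf P_\perp}\in\mathbb R$ with $\|\mathbf P\boldsymbol\eta\|\le M_{\mathbf P}\|\boldsymbol\eta\|$ for all $\boldsymbol\eta\in\mathbb R^{\bar N}$ and $\|\mathbf P_\perp\boldsymbol\eta\|\le M_{\mathbf P_\perp}\|\boldsymbol\eta\|$ for all $\boldsymbol\eta\in\mathbb R^{N-\bar N}$; (ii) the fine propagator is stable: there is a constant $C_{\mathcal F}\ge0$ with $\|\mathcal F(\boldsymbol\xi;t^i,t^j)\|\le(1+C_{\mathcal F}(t^j-t^i))\|\boldsymbol\xi\|$ for all $\boldsymbol\xi\in\mathbb R^N$ and $0\le i\le j\le m$; (iii) there are constants $M_\perp,M_{\mathbf r_j}\in\mathbb R$ with $\|\mathbf P_\perp\mathbf R_\perp^T\boldsymbol\xi\|\le M_\perp\|\boldsymbol\xi\|$ and $\|\mathbf r_j^T\boldsymbol\xi\|\le M_{\mathbf r_j}\|\boldsymbol\xi\|$ for all $\boldsymbol\xi\in\mathbb R^N$, $j=1,\dots,\bar N$. Then for all $\boldsymbol\xi\in\mathbb R^N$ and $n\in\{0,\dots,M-1\}$, $$\|\mathcal G_{\mathrm{LF}}(\boldsymbol\xi;T^n,T^{n+1})\|\le\sqrt{\bar N}\,M_{\mathbf P}\max_{1\le j\le\bar N}M_{\mathbf r_j}\alpha_j^n\left(1+C_j^nC_{\mathcal F}H\right)\|\boldsymbol\xi\|,$$ where $$\alpha_j^n:=\lambda_j^n+\kappa_j^n\sqrt\alpha\ \ge 1,\qquad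 C_j^n:=\frac{(\alpha/\bar m)\kappa_j^n\sqrt\alpha}{\lambda_j^n+\kappa_j^n\sqrt\alpha}\ \le 1,\qquad \lambda_j^n:=\Big|1-\sum_{i=1}^\alpha\gamma_{ij}^n\Big|,\qquad\kappa_j^n:=\sqrt{\sum_{i=1}^\alpha(\gamma_{ij}^n)^2}.$$ Hence the proposed coarse propagator is stable, in the sense that there are constants $\alpha_A,C_A$ with $\|\mathcal G_{\mathrm{LF}}(\boldsymbol\xi;T^n,T^{n+1})\|\le\alpha_A(1+C_AH)\|\boldsymbol\xi\|$.
   Context: Norms are Euclidean. Let $N,M,\bar m$ be positive integers, $m=\bar m M$, $T_{\mathrm{final}}>0$, $h=T_{\mathrm{final}}/m$, $H=T_{\mathrm{final}}/M=\bar m h$; fine time instances $t^i=ih$ ($0\le i\le m$), coarse time instances $T^n=nH=t^{\bar m n}$ ($0\le n\le M$). The fine propagator $\mathcal F(\boldsymbol\xi;t^i,t^j)\in\mathbb R^N$ propagates a state $\boldsymbol\xi\in\mathbb R^N$ from $t^i$ to $t^j$ ($i\le j$), with $\mathcal F(\cdot;t^i,t^k)=\mathcal F(\cdot;t^j,t^k)\circ\mathcal F(\cdot;t^i,t^j)$ for $i\le j\le k$. Let $1\le\bar N\le N$, $\mathbf R=[\mathbf r_1\ \cdots\ \mathbf r_{\bar N}]\in\mathbb R^{N\times\bar N}$ (restriction operator $\mathbf R^T$), $\mathbf P\in\mathbb R^{N\times\bar N}$ (prolongation operator), with counterparts $\mathbf R_\perp,\mathbf P_\perp\in\mathbb R^{N\times(N-\bar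 N)}$. The memory $\alpha$ and basis dimension $a$ are positive integers with $a\le\alpha\le\bar m$. For $1\le j\le\bar N$, $0\le n\le M-1$, the local time-evolution basis $\boldsymbol\Xi_j^n\in\mathbb R^{\bar m\times a}$ has orthonormal columns. $\mathbf Z_0\in\{0,1\}^{\alpha\times\bar m}$ extracts the first $\alpha$ entries of a vector in $\mathbb R^{\bar m}$. With $^+$ the Moore--Penrose pseudoinverse and $\mathbf e_i$ canonical unit vectors, $\gamma_{ij}^n:=\mathbf e_{\bar m}^T\boldsymbol\Xi_j^n[\mathbf Z_0\boldsymbol\Xi_j^n]^+\mathbf e_i$ ($1\le i\le\alpha$) and $\boldsymbol\Gamma_i^n:=\mathrm{diag}(\gamma_{i1}^n,\dots,\gamma_{i\bar N}^n)$. The local-forecast coarse propagator is $$\mathcal G_{\mathrm{LF}}(\boldsymbol\xi;T^n,T^{n+1})=\mathbf P\mathbf R^T\boldsymbol\xi+\mathbf P\sum_{i=1}^{\alpha}\boldsymbol\Gamma_i^n\left[\mathbf R^T\mathcal F(\boldsymbol\xi;T^n,t^{\bar m n+i})-\mathbf R^T\boldsymbol\xi\right].$$ The maximum over $j$ is taken of the whole product $M_{\mathbf r_j}\alpha_j^n(1+C_j^nC_{\mathcal F}H)$. *)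

(* Defs.v *)
From mathcomp Require Import all_boot all_order all_algebra.
From mathcomp Require Import reals.
Set Implicit Arguments.
Unset Strict Implicit.
Unset Printing Implicit Defensive.
Import Order.TTheory GRing.Theory Num.Theory.
Local Open Scope ring_scope.

Definition enorm (R : realType) (n : nat) (x : 'cV[R]_n) : R :=
  Num.sqrt (\sum_(i < n) x i 0 ^+ 2).

(* Canonical unit vector e_k with 1-based index k (zero unless 1 <= k <= n). *)
Definition unitv (R : realType) (n k : nat) : 'cV[R]_n :=
  \col_(i < n) (i.+1 == k)%:R.

(* The seed [f (Ordinal n_gt0)] is itself one of the values, so this is the
   maximum of the family whatever the signs of its members. *)
Definition ord_maxr (R : realType) (n : nat) (n_gt0 : (0 < n)%N)
    (f : 'I_n -> R) : R :=
  \big[Num.max/f (Ordinal n_gt0)]_(j < n) f j.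

(** Moore-Penrose pseudoinverse.  MathComp's [pinvmx] is only a partial inverse
    and does not satisfy the symmetry conditions below. *)

Definition is_mpinv (R : realType) (m n : nat)
    (A : 'M[R]_(m, n)) (B : 'M[R]_(n, m)) : Prop :=
  [/\ A *m B *m A = A, B *m A *m B = B,
      (A *m B)^T = A *m B & (B *m A)^T = B *m A].

(* With A = C D the full-rank factorization,
   A^+ = D^T (D D^T)^-1 (C^T C)^-1 C^T. *)
Definition mpinv (R : realType) (m n : nat) (A : 'M[R]_(m, n)) : 'M[R]_(n, m) :=
  let C := col_base A in
  let D := row_base A in
  D^T *m invmx (D *m D^T) *m invmx (C^T *m C) *m C^T.

Lemma gram_unit (R : realType) (m n : nat) (D : 'M[R]_(m, n)) :
  row_free D -> D *m D^T \in unitmx.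
Proof.
move=> Dfree; rewrite -row_free_unit; apply: inj_row_free => v vDD0.
apply: (row_free_inj Dfree); rewrite mul0mx; apply/rowP => j.
have : (v *m D *m (v *m D)^T) 0 0 = 0.
  by rewrite trmx_mul mulmxA -(mulmxA v) vDD0 mul0mx mxE.
rewrite mxE => /eqP; rewrite psumr_eq0 => [/allP/(_ j (mem_index_enum j))|i _].
  by rewrite !mxE implyTb -expr2 sqrf_eq0 => /eqP.
by rewrite [_^T _ _]mxE -expr2 sqr_ge0.
Qed.

Lemma mpinvP (R : realType) (m n : nat) (A : 'M[R]_(m, n)) :
  is_mpinv A (mpinv A).
Proof.
have DU : row_base A *m (row_base A)^T \in unitmx.
  by apply: gram_unit; rewrite row_base_free.
have CU : (col_base A)^T *m col_base A \in unitmx.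
  rewrite -{2}[col_base A]trmxK; apply: gram_unit.
  by have := col_base_full A; rewrite /row_full /row_free mxrank_tr.
have eA := mulmx_base A.
rewrite /is_mpinv /mpinv /=; move: (\rank A) (col_base A) (row_base A) eA CU DU.
move=> r C D <- CU DU.
set X := invmx (D *m D^T); set Y := invmx (C^T *m C).
have XT : X^T = X by rewrite /X trmx_inv trmx_mul trmxK.
have YT : Y^T = Y by rewrite /Y trmx_inv trmx_mul trmxK.
have AB : C *m D *m (D^T *m X *m Y *m C^T) = C *m Y *m C^T.
  by rewrite !mulmxA -(mulmxA C D) -(mulmxA C (D *m D^T)) mulmxV // mulmx1.
have BA : D^T *m X *m Y *m C^T *m (C *m D) = D^T *m X *m D.
  by rewrite !mulmxA -(mulmxA _ C^T C) -(mulmxA _ Y (C^T *m C)) mulVmx // mulmx1.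
split.
- rewrite AB !mulmxA -(mulmxA _ C^T C) -(mulmxA _ Y (C^T *m C)).
  by rewrite mulVmx // mulmx1.
- rewrite BA !mulmxA -(mulmxA _ D D^T) -(mulmxA _ X (D *m D^T)).
  by rewrite mulVmx // mulmx1.
- by rewrite AB !trmx_mul trmxK YT mulmxA.
- by rewrite BA !trmx_mul trmxK XT mulmxA.
Qed.

Lemma mpinv_uniq (R : realType) (m n : nat) (A : 'M[R]_(m, n))
    (B B' : 'M[R]_(n, m)) :
  is_mpinv A B -> is_mpinv A B' -> B = B'.
Proof.
move=> [a1 a2 a3 a4] [b1 b2 b3 b4].
have eAB : A *m B = A *m B'.
  rewrite -a3 -{1}b1 -mulmxA trmx_mul a3 b3 !mulmxA.
  by rewrite a1.
have eBA : B *m A = B' *m A.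
  rewrite -a4 -{1}b1 mulmxA -(mulmxA B) mulmxA -!mulmxA (mulmxA B A) trmx_mul.
  by rewrite a4 b4 -mulmxA (mulmxA A B A) a1.
by rewrite -a2 eBA -mulmxA eAB mulmxA b2.
Qed.

(** Time grids: [grid T k i] is the i-th instance of the uniform grid with k
    intervals on [0, T]; the fine grid has k = mb * M and the coarse one k = M. *)

Definition step (R : realType) (T : R) (k : nat) : R := T / k%:R.

Definition grid (R : realType) (T : R) (k i : nat) : R := i%:R * step T k.

(** Local-forecast coarse propagator; [mb] is \bar m and [Nb] is \bar N.
    The indices i of gamma_{ij}^n, Gamma_i^n and t^i are kept 1-based as naturals;
    the index j is 0-based in ['I_Nb]. *)

(* [pid_mx al] is Z_0: with al <= mb rows, it extracts the first al entries. *)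
Definition gamma (R : realType) (mb a al : nat) (Xi : 'M[R]_(mb, a)) (i : nat) : R :=
  ((unitv R mb mb)^T *m Xi *m mpinv ((pid_mx al : 'M[R]_(al, mb)) *m Xi)
     *m unitv R al i) 0 0.

Definition Gamma (R : realType) (Nb mb a al : nat)
    (Xi : 'I_Nb -> 'M[R]_(mb, a)) (i : nat) : 'M[R]_Nb :=
  diag_mx (\row_(j < Nb) gamma al (Xi j) i).

(* [F xi s t] is the fine propagator from time s to time t; only its values at
   fine time instances matter.  [GLF ... n xi] goes from T^n to T^{n+1}. *)
Definition GLF (R : realType) (N Nb M mb a al : nat) (T : R)
    (F : 'cV[R]_N -> R -> R -> 'cV[R]_N) (Rm P : 'M[R]_(N, Nb))
    (Xi : 'I_M -> 'I_Nb -> 'M[R]_(mb, a)) (n : 'I_M) (xi : 'cV[R]_N) : 'cV[R]_N :=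
  P *m Rm^T *m xi +
  P *m \sum_(1 <= i < al.+1)
         Gamma al (Xi n) i *m
           (Rm^T *m F xi (grid T M n) (grid T (mb * M) (mb * n + i))
            - Rm^T *m xi).

Definition lambda (R : realType) (mb a al : nat) (Xi : 'M[R]_(mb, a)) : R :=
  `|1 - \sum_(1 <= i < al.+1) gamma al Xi i|.

Definition kappa (R : realType) (mb a al : nat) (Xi : 'M[R]_(mb, a)) : R :=
  Num.sqrt (\sum_(1 <= i < al.+1) gamma al Xi i ^+ 2).

(* The constants alpha_j^n and C_j^n for the basis Xi_j^n. *)
Definition alphac (R : realType) (mb a al : nat) (Xi : 'M[R]_(mb, a)) : R :=
  lambda al Xi + kappa al Xi * Num.sqrt al%:R.

Definition Cc (R : realType) (mb a al : nat) (Xi : 'M[R]_(mb, a)) : R :=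
  (al%:R / mb%:R) * kappa al Xi * Num.sqrt al%:R
    / (lambda al Xi + kappa al Xi * Num.sqrt al%:R).

(* Main.v *)
(** Row [j] of the vector that [P] prolongs is
    [(1 - \sum_i gamma_ij) r_j^T xi + \sum_i gamma_ij r_j^T F_i].  The first term
    contributes [lambda_j]; Cauchy-Schwarz in [i], with
    [|F_i| <= (1 + C_F al h) |xi|] for every [i <= al], bounds the second by
    [kappa_j sqrt(al) (1 + C_F al h)], and [al h = (al / mb) H].  Cauchy-Schwarz
    against the constant vector [1] also gives
    [1 <= lambda_j + |\sum_i gamma_ij| <= alpha_j]. *)
Require Import Defs.
From mathcomp Require Import all_boot all_order all_algebra.
From mathcomp Require Import reals ring lra.
Set Implicit Arguments.
Unset Strict Implicit.
Unset Printing Implicit Defensive.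
Import Order.TTheory GRing.Theory Num.Theory.
Local Open Scope ring_scope.

(** Induction on the list. The step is [p * q + s * t <= sqrt ((p^2 + s^2) * (q^2 + t^2))], which
    after squaring is [0 <= (p * t - q * s)^2]; here [p], [q] are the absolute values at the head
    and [s], [t] the square roots for the tail. *)
Lemma cauchy_schwarz_seq (R : rcfType) (I : Type) (r : seq I) (f g : I -> R) :
  `|\sum_(i <- r) f i * g i| <=
  Num.sqrt (\sum_(i <- r) f i ^+ 2) * Num.sqrt (\sum_(i <- r) g i ^+ 2).
Proof.
elim: r => [|i r IHr]; first by rewrite !big_nil sqrtr0 mul0r normr0.
rewrite !big_cons; apply: le_trans (ler_normD _ _) _.
have sumsq_ge0 (u : I -> R) : 0 <= \sum_(i <- r) u i ^+ 2.
  by apply: sumr_ge0 => k _; apply: sqr_ge0.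
move: IHr (sumsq_ge0 f) (sumsq_ge0 g).
move: (\sum_(j <- r) f j ^+ 2) (\sum_(j <- r) g j ^+ 2) => A B IHr A0 B0.
apply: le_trans (lerD (lexx _) IHr) _.
rewrite -[leRHS]sqrtrM ?addr_ge0 ?sqr_ge0 // normrM.
have h0 : 0 <= `|f i| * `|g i| + Num.sqrt A * Num.sqrt B.
  by rewrite addr_ge0 ?mulr_ge0 ?sqrtr_ge0.
rewrite -(ger0_norm h0) -[leLHS]sqrtr_sqr ler_wsqrtr //.
rewrite -{2}(sqr_sqrtr A0) -{2}(sqr_sqrtr B0) -(real_normK (num_real (f i))).
rewrite -(real_normK (num_real (g i))).
have := sqr_ge0 (`|f i| * Num.sqrt B - `|g i| * Num.sqrt A).
move: `|f i| `|g i| (Num.sqrt A) (Num.sqrt B) => p q s t; nra.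
Qed.

Lemma ler_ord_maxr (R : realType) (n : nat) (n_gt0 : (0 < n)%N)
    (f : 'I_n -> R) (j : 'I_n) : f j <= ord_maxr n_gt0 f.
Proof. exact: le_bigmax. Qed.

Lemma ord_maxr_le (R : realType) (n : nat) (n_gt0 : (0 < n)%N)
    (f : 'I_n -> R) (c : R) : (forall j, f j <= c) -> ord_maxr n_gt0 f <= c.
Proof. by move=> f_le; apply: bigmax_le. Qed.

Lemma enorm_ge0 (R : realType) (n : nat) (x : 'cV[R]_n) : 0 <= enorm x.
Proof. exact: sqrtr_ge0. Qed.

Lemma enorm_const1 (R : realType) (n : nat) :
  enorm (const_mx 1 : 'cV[R]_n) = Num.sqrt n%:R.
Proof.
congr Num.sqrt; under eq_bigr do rewrite mxE expr1n.
by rewrite big_const_ord iter_addr_0.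
Qed.

Lemma enorm_mx11 (R : realType) (x : 'cV[R]_1) : enorm x = `|x 0 0|.
Proof. by rewrite /enorm big_ord1 sqrtr_sqr. Qed.

(** Source of the factor [Num.sqrt Nb%:R]: a bound uniform over the rows of the prolonged vector
    becomes a norm bound. *)
Lemma enorm_le_coord (R : realType) (n : nat) (x : 'cV[R]_n) (c : R) :
  0 <= c -> (forall i, `|x i 0| <= c) -> enorm x <= Num.sqrt n%:R * c.
Proof.
move=> c0 x_le; rewrite -[X in _ * X](ger0_norm c0) -sqrtr_sqr -sqrtrM ?ler0n //.
apply: ler_wsqrtr; apply: (@le_trans _ _ (\sum_(i < n) c ^+ 2)).
  by apply: ler_sum => i _; rewrite -(real_normK (num_real _)) lerXn2r ?nnegrE.
by rewrite big_const_ord iter_addr_0 mulr_natl.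
Qed.

(** No sign is assumed for [MP] and [Mr j]; it is recovered by testing their bounds on the all-ones
    vector, whose norm is positive. *)
Lemma enorm_bound_ge0 (R : realType) (n : nat) (f : 'cV[R]_n -> R) (c : R) :
  (0 < n)%N -> (forall x, 0 <= f x) -> (forall x, f x <= c * enorm x) -> 0 <= c.
Proof.
move=> n_gt0 f_ge0 f_le; have := le_trans (f_ge0 _) (f_le (const_mx 1)).
by rewrite enorm_const1 pmulr_lge0 // sqrtr_gt0 ltr0n.
Qed.

Lemma step_coarse (R : realType) (T : R) (mb M : nat) : (0 < mb)%N ->
  step T M = mb%:R * step T (mb * M).
Proof.
move=> mb0; rewrite /step natrM invfM mulrCA; congr (_ * _).
by rewrite mulrA divff ?mul1r // pnatr_eq0 -lt0n.
Qed.

Lemma grid_coarse (R : realType) (T : R) (mb M n : nat) : (0 < mb)%N ->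
  grid T M n = grid T (mb * M) (mb * n).
Proof.
by move=> mb0; rewrite /grid (step_coarse T M mb0) natrM mulrA [mb%:R * _]mulrC.
Qed.

Lemma lambda_ge0 (R : realType) (mb a al : nat) (Xi : 'M[R]_(mb, a)) :
  0 <= lambda al Xi.
Proof. exact: normr_ge0. Qed.

Lemma kappa_sqrt_ge0 (R : realType) (mb a al : nat) (Xi : 'M[R]_(mb, a)) :
  0 <= kappa al Xi * Num.sqrt al%:R.
Proof. by rewrite mulr_ge0 ?sqrtr_ge0. Qed.

(** Serves twice: with [g] constantly 1 it yields [1 <= alphac], and with [g] the restricted fine
    states it bounds the forecast sum. *)
Lemma gamma_sum_le (R : realType) (mb a al : nat) (Xi : 'M[R]_(mb, a))
    (g : nat -> R) (c : R) : 0 <= c ->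
  (forall i, (0 < i <= al)%N -> `|g i| <= c) ->
  `|\sum_(1 <= i < al.+1) gamma al Xi i * g i| <=
  kappa al Xi * Num.sqrt al%:R * c.
Proof.
move=> c0 g_le; apply: le_trans (cauchy_schwarz_seq _ _ _) _.
rewrite -/(kappa al Xi) -mulrA ler_wpM2l ?sqrtr_ge0 //.
rewrite -[X in _ <= _ * X](ger0_norm c0) -[X in _ <= _ * X]sqrtr_sqr.
rewrite -[leRHS]sqrtrM ?ler0n // ler_wsqrtr //.
apply: (@le_trans _ _ (\sum_(1 <= i < al.+1) c ^+ 2)).
  apply: ler_sum_nat => i i_bnd.
  by rewrite -(real_normK (num_real _)) lerXn2r ?nnegrE ?g_le.
by rewrite sumr_const_nat subn1 mulr_natl.
Qed.

Lemma alphac_ge1 (R : realType) (mb a al : nat) (Xi : 'M[R]_(mb, a)) :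
  1 <= alphac al Xi.
Proof.
have norm1_le i : (0 < i <= al)%N -> `|1 : R| <= 1 by rewrite normr1.
have := gamma_sum_le Xi ler01 norm1_le.
under eq_bigr do rewrite mulr1.
rewrite mulr1 /alphac /lambda => sum_le; apply: le_trans (lerD (lexx _) sum_le).
by apply: le_trans (ler_normD _ _); rewrite subrK normr1.
Qed.

(** Clears the denominator of [Cc], which is [alphac] and hence at least 1. Both [Cc_le1] and the
    main estimate work with this product rather than with the quotient. *)
Lemma Cc_alphac (R : realType) (mb a al : nat) (Xi : 'M[R]_(mb, a)) :
  Cc al Xi * alphac al Xi =
  (al%:R / mb%:R) * (kappa al Xi * Num.sqrt al%:R).
Proof.
rewrite /Cc -/(alphac al Xi) divfK ?mulrA //.
by rewrite gt_eqF // (lt_le_trans ltr01 (alphac_ge1 al Xi)).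
Qed.

Lemma Cc_le1 (R : realType) (mb a al : nat) (Xi : 'M[R]_(mb, a)) :
  (al <= mb)%N -> Cc al Xi <= 1.
Proof.
move=> al_le; have alpha0 := lt_le_trans ltr01 (alphac_ge1 al Xi).
rewrite -(ler_pM2r alpha0) Cc_alphac mul1r.
apply: (@le_trans _ _ (kappa al Xi * Num.sqrt al%:R)); last first.
  by rewrite lerDr lambda_ge0.
rewrite ler_piMl ?kappa_sqrt_ge0 //.
(* For [mb = 0] the ratio is 0, since the inverse of 0 is 0. *)
have [->|mb0] := posnP mb; first by rewrite invr0 mulr0 ler01.
by rewrite ler_pdivrMr ?ltr0n // mul1r ler_nat.
Qed.

(** Each [Gamma] is diagonal, so the rows decouple; collecting the multiples of the restricted [xi]
    produces the coefficient whose absolute value is [lambda]. *)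
Lemma GLF_row (R : realType) (N Nb M mb a al : nat) (T : R)
    (F : 'cV[R]_N -> R -> R -> 'cV[R]_N) (Rm P : 'M[R]_(N, Nb))
    (Xi : 'I_M -> 'I_Nb -> 'M[R]_(mb, a)) (n : 'I_M) (xi : 'cV[R]_N) :
  GLF al T F Rm P Xi n xi = P *m \col_(j < Nb)
    ((1 - \sum_(1 <= i < al.+1) gamma al (Xi n j) i) * (Rm^T *m xi) j 0 +
     \sum_(1 <= i < al.+1) gamma al (Xi n j) i *
       (Rm^T *m F xi (grid T M n) (grid T (mb * M) (mb * n + i))) j 0).
Proof.
rewrite /GLF -mulmxA -mulmxDr; congr (_ *m _).
apply/colP => j; rewrite [LHS]mxE [RHS]mxE summxE mulrBl mul1r -addrA; congr (_ + _).
rewrite mulr_suml -sumrN -big_split; apply: eq_bigr => i _ /=.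
rewrite mul_diag_mx mxE [X in X * _]mxE [X in _ * X]mxE [X in _ * (_ + X)]mxE.
by rewrite mulrBr addrC.
Qed.

Theorem lemma4p9 (R : realType) (N M mb Nb a al : nat) (T : R)
  (N_gt0 : (0 < N)%N) (M_gt0 : (0 < M)%N) (mb_gt0 : (0 < mb)%N)
  (Nb_gt0 : (0 < Nb)%N) (Nb_le_N : (Nb <= N)%N)
  (a_gt0 : (0 < a)%N) (a_le_al : (a <= al)%N) (al_le_mb : (al <= mb)%N)
  (T_gt0 : 0 < T)
  (F : 'cV[R]_N -> R -> R -> 'cV[R]_N)
  (F_comp : forall i j k : nat, (i <= j)%N -> (j <= k)%N -> (k <= mb * M)%N ->
    forall xi : 'cV[R]_N,
      F xi (grid T (mb * M) i) (grid T (mb * M) k) =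
      F (F xi (grid T (mb * M) i) (grid T (mb * M) j))
        (grid T (mb * M) j) (grid T (mb * M) k))
  (Rm P : 'M[R]_(N, Nb)) (Rperp Pperp : 'M[R]_(N, N - Nb))
  (Xi : 'I_M -> 'I_Nb -> 'M[R]_(mb, a))
  (Xi_orthonormal : forall (n : 'I_M) (j : 'I_Nb), (Xi n j)^T *m Xi n j = 1%:M)
  (MP MPperp : R)
  (P_bound : forall eta : 'cV[R]_Nb, enorm (P *m eta) <= MP * enorm eta)
  (Pperp_bound : forall eta : 'cV[R]_(N - Nb),
    enorm (Pperp *m eta) <= MPperp * enorm eta)
  (CF : R) (CF_ge0 : 0 <= CF)
  (F_stable : forall (xi : 'cV[R]_N) (i j : nat), (i <= j)%N -> (j <= mb * M)%N ->
    enorm (F xi (grid T (mb * M) i) (grid T (mb * M) j)) <=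
    (1 + CF * (grid T (mb * M) j - grid T (mb * M) i)) * enorm xi)
  (Mperp : R) (Mr : 'I_Nb -> R)
  (perp_bound : forall xi : 'cV[R]_N,
    enorm (Pperp *m Rperp^T *m xi) <= Mperp * enorm xi)
  (r_bound : forall (j : 'I_Nb) (xi : 'cV[R]_N),
    enorm ((col j Rm)^T *m xi) <= Mr j * enorm xi) :
  [/\ forall (xi : 'cV[R]_N) (n : 'I_M),
        enorm (GLF al T F Rm P Xi n xi) <=
        Num.sqrt Nb%:R * MP *
        ord_maxr Nb_gt0 (fun j : 'I_Nb =>
          Mr j * alphac al (Xi n j) * (1 + Cc al (Xi n j) * CF * step T M)) *
        enorm xi,
      forall (n : 'I_M) (j : 'I_Nb), 1 <= alphac al (Xi n j),
      forall (n : 'I_M) (j : 'I_Nb), Cc al (Xi n j) <= 1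
    & exists alphaA CA : R, forall (xi : 'cV[R]_N) (n : 'I_M),
        enorm (GLF al T F Rm P Xi n xi) <= alphaA * (1 + CA * step T M) * enorm xi].
Proof.
have Mr_ge0 j : 0 <= Mr j.
  by apply: (enorm_bound_ge0 N_gt0 _ (r_bound j)) => x; apply: enorm_ge0.
have MP_ge0 : 0 <= MP.
  by apply: (enorm_bound_ge0 Nb_gt0 _ P_bound) => x; apply: enorm_ge0.
have row_le j x : `|(Rm^T *m x) j 0| <= Mr j * enorm x.
  suff -> : (Rm^T *m x) j 0 = ((col j Rm)^T *m x) 0 0.
    by rewrite -enorm_mx11 r_bound.
  by rewrite !mxE; apply: eq_bigr => k _; rewrite !mxE.
have h_ge0 k : 0 <= step T k by rewrite divr_ge0 ?ler0n ?ltW.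
have stableF xi (n : 'I_M) i : (0 < i <= al)%N ->
    enorm (F xi (grid T M n) (grid T (mb * M) (mb * n + i))) <=
    (1 + CF * (al%:R * step T (mb * M))) * enorm xi.
  (* Seen on the fine grid, the run goes from index [mb * n] to [mb * n + i]. The end index is at
     most [mb * n.+1 <= mb * M], because [i <= al <= mb] and [n < M], and the elapsed time is [i]
     fine steps, at most [al] of them. *)
  move=> /andP[_ i_le]; rewrite (grid_coarse T M n mb_gt0).
  apply: le_trans (F_stable _ _ _ _ _) _; first exact: leq_addr.
    apply: (@leq_trans (mb * n.+1)); last by rewrite leq_mul2l ltn_ord orbT.
    by rewrite mulnS addnC leq_add2r (leq_trans i_le).
  rewrite ler_wpM2r ?enorm_ge0 // lerD2l ler_wpM2l // /grid -mulrBl.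
  by rewrite natrD addrAC subrr add0r ler_wpM2r // ler_nat.
have bound xi (n : 'I_M) : enorm (GLF al T F Rm P Xi n xi) <=
    Num.sqrt Nb%:R * MP * ord_maxr Nb_gt0 (fun j : 'I_Nb =>
      Mr j * alphac al (Xi n j) * (1 + Cc al (Xi n j) * CF * step T M)) * enorm xi.
  rewrite GLF_row; apply: le_trans (P_bound _) _.
  rewrite [Num.sqrt _ * MP]mulrC -!mulrA ler_wpM2l //; set mx := ord_maxr _ _.
  have row_bound j :
      `|(1 - \sum_(1 <= i < al.+1) gamma al (Xi n j) i) * (Rm^T *m xi) j 0 +
        \sum_(1 <= i < al.+1) gamma al (Xi n j) i *
          (Rm^T *m F xi (grid T M n) (grid T (mb * M) (mb * n + i))) j 0| <=
      mx * enorm xi.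
    pose c := 1 + CF * (al%:R * step T (mb * M)).
    have c_ge0 : 0 <= c by apply: addr_ge0 => //; rewrite 2?mulr_ge0 ?h_ge0 ?ler0n.
    apply: (@le_trans _ _ (Mr j * alphac al (Xi n j) *
        (1 + Cc al (Xi n j) * CF * step T M) * enorm xi)); last first.
      rewrite ler_wpM2r ?enorm_ge0 //.
      exact: (ler_ord_maxr Nb_gt0 (fun j => Mr j * alphac al (Xi n j) *
        (1 + Cc al (Xi n j) * CF * step T M))).
    (* By [Cc_alphac] and [step T M = mb * step T (mb * M)] the factor [mb] cancels, so the product
       splits into the bounds of the two terms of row [j]. *)
    have -> : Mr j * alphac al (Xi n j) *
          (1 + Cc al (Xi n j) * CF * step T M) * enorm xi =
        lambda al (Xi n j) * (Mr j * enorm xi) +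
        kappa al (Xi n j) * Num.sqrt al%:R * (Mr j * (c * enorm xi)).
      transitivity (Mr j * enorm xi * (alphac al (Xi n j) +
        Cc al (Xi n j) * alphac al (Xi n j) * CF * step T M)); first by ring.
      rewrite Cc_alphac (step_coarse T M mb_gt0) /c /alphac.
      by field; rewrite pnatr_eq0 -lt0n.
    apply: le_trans (ler_normD _ _) (lerD _ _).
      by rewrite normrM ler_wpM2l ?normr_ge0.
    apply: gamma_sum_le => [|i i_bnd]; first by rewrite !mulr_ge0 ?enorm_ge0.
    by apply: le_trans (row_le _ _) _; rewrite ler_wpM2l ?stableF.
  apply: enorm_le_coord => [|j]; last by rewrite mxE row_bound.
  (* The bound [mx * enorm xi] is nonnegative because it dominates the absolute value in row 0,
     which exists as [Nb > 0]. *)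
  exact: le_trans (row_bound (Ordinal Nb_gt0)).
split=> // [n j|n j|]; [exact: alphac_ge1 | exact: Cc_le1 |].
(* [alphaA] must not depend on [n]: summing the nonnegative terms over all [n] and [j] dominates
   each of them. [CA = CF] suffices because [Cc <= 1]. *)
exists (Num.sqrt Nb%:R * MP *
  \sum_(n < M) \sum_(j < Nb) Mr j * alphac al (Xi n j)), CF.
move=> xi n; apply: le_trans (bound xi n) _.
have term_ge0 k j : 0 <= Mr j * alphac al (Xi k j).
  by rewrite mulr_ge0 // (le_trans ler01 (alphac_ge1 _ _)).
rewrite ler_wpM2r ?enorm_ge0 // -[leRHS]mulrA ler_wpM2l ?mulr_ge0 ?sqrtr_ge0 //.
apply: ord_maxr_le => j.
apply: (@le_trans _ _ (Mr j * alphac al (Xi n j) * (1 + CF * step T M))).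
  by rewrite ler_wpM2l // lerD2l ler_wpM2r // ler_piMl // Cc_le1.
have c_ge0 : 0 <= 1 + CF * step T M by apply: addr_ge0 => //; apply: mulr_ge0.
rewrite ler_wpM2r //.
rewrite (bigD1 n) //= (bigD1 j) //= -addrA lerDl addr_ge0 ?sumr_ge0 // => k _.
exact: sumr_ge0.
Qed.
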